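(* For every $c$ with $0<c<1$, $$\inf_{f,g\in S^1}\ \sup_{|z|\le c}\left|\frac{f(z)}{g(z)}\right|=0.$$
   Context: $\mathbb{D}=\{z\in\mathbb{C}:|z|<1\}$. The Bergman space $\mathcal{A}^2(\mathbb{D})$ is the set of analytic functions $f$ on $\mathbb{D}$ with $\|f\|_2=\left(\frac1\pi\int_{\mathbb{D}}|f(z)|^2\,dA(z)\right)^{1/2}<\infty$, where $dA$ is Lebesgue area measure. $S^1=\{f\in\mathcal{A}^2(\mathbb{D}):\|f\|_2=1\}$. The quotient $f/g$ is understood as a meromorphic function on $\mathbb{D}$ (common zeros cancelled, value $\infty$ at poles). *)

(* Defs.v *)
From HB Require Import structures.
From mathcomp Require Import all_boot all_order all_algebra.
From mathcomp Require Import all_classical all_reals all_analysis.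
From mathcomp Require Import complex.

Set Implicit Arguments.
Unset Strict Implicit.
Unset Printing Implicit Defensive.

Import Order.TTheory GRing.Theory Num.Theory.
Import numFieldNormedType.Exports.

Local Open Scope classical_set_scope.
Local Open Scope ring_scope.

Section Bergman.
Variable R : realType.
Local Notation C := R[i].
Implicit Types (f g : C -> C) (z w : C).

(* The norm `|z| of the library is C-valued; this is the real modulus. *)
Definition cabs z : R := Normc.normc z.

Definition unit_disk : set C := [set z | cabs z < 1].

(* Only the values on the disk matter: functions on the disk are represented
   by total functions.  Derivability over the field C is complex
   differentiability. *)
Definition analytic_on_disk f : Prop :=
  forall z, unit_disk z -> derivable (f : C^o -> C^o) z 1.

(* Area measure lives on R * R, identified with C by (x, y) |-> x + i y. *)
Definition area_measure :
    {measure set (measurableTypeR R * measurableTypeR R) -> \bar R} :=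
  (@lebesgue_measure R \x @lebesgue_measure R)%E.

Definition complex_of_pair (p : R * R) : C := Complex p.1 p.2.

(* Takes the value +oo when the integral diverges. *)
Definition bergman_norm f : \bar R :=
  (((pi^-1)%:E *
    \int[area_measure]_(p in complex_of_pair @^-1` unit_disk)
      (cabs (f (complex_of_pair p)) ^+ 2)%:E) `^ 2^-1)%E.

Definition bergman_space : set (C -> C) :=
  [set f | analytic_on_disk f /\ (bergman_norm f < +oo)%E].

Definition bergman_sphere : set (C -> C) :=
  [set f | bergman_space f /\ bergman_norm f = 1%E].

(* [v] is the value at [z] of the meromorphic function f/g: cancel the largest
   common power of (w - z) from f and g, then divide; None stands for the
   value oo at a pole. *)
Definition is_quotient_at f g z (v : option C) : Prop :=
  exists (n : nat) (F G : C -> C),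
    [/\ analytic_on_disk F /\ analytic_on_disk G,
        forall w, unit_disk w ->
          f w = (w - z) ^+ n * F w /\ g w = (w - z) ^+ n * G w,
        ~ (F z = 0 /\ G z = 0)
      & v = if G z == 0 then None else Some (F z / G z)].

(* A value exists and is unique when f and g are analytic on the disk and not
   both identically zero there (uniqueness is [is_quotient_at_unique] below);
   the default oo is never used in that case. *)
Definition mero_quotient f g z : option C := xget None (is_quotient_at f g z).

Definition mero_abs (v : option C) : \bar R :=
  if v is Some z then (cabs z)%:E else +oo%E.

Let near_disk z : unit_disk z -> \forall w \near (z : C^o), unit_disk w.
Proof.
rewrite /unit_disk /= => z1; apply/nbhs_ballP.
exists (1 - cabs z)%:C%C => /=; first by rewrite ltcR subr_gt0.
move=> w; rewrite /ball /= => zw.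
have {}zw : cabs (z - w) < 1 - cabs z by rewrite -ltcR.
have wE : w = z - (z - w) by rewrite opprB addrC subrK.
rewrite wE; apply: le_lt_trans (@le_normcD R z (- (z - w))) _.
by rewrite normcN addrC -ltrBrDr.
Qed.

Let analytic_cvg f z : analytic_on_disk f -> unit_disk z ->
  f w @[w --> (z : C^o)^'] --> (f z : C^o).
Proof.
move=> af dz; apply: (@cvg_trans _ (f w @[w --> (z : C^o)] : set_system C^o)).
  exact: cvg_within_filter.
by have /derivable1_diffP/differentiable_continuous := af _ dz.
Qed.

Lemma is_quotient_at_unique f g z v v' : unit_disk z ->
  is_quotient_at f g z v -> is_quotient_at f g z v' -> v = v'.
Proof.
move=> dz [n [F [G [[aF aG] fg FG ->]]]] [m [F' [G' [[aF' aG'] fg' FG' ->]]]].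
have cross : F z * G' z = F' z * G z.
  have L1 : (F w * G' w : C^o) @[w --> (z : C^o)^'] --> (F z * G' z : C^o).
    by apply: cvgM; exact: analytic_cvg.
  have L2 : (F' w * G w : C^o) @[w --> (z : C^o)^'] --> (F' z * G z : C^o).
    by apply: cvgM; exact: analytic_cvg.
  apply: (@cvg_unique C^o (@norm_hausdorff _ _) _ _ _ _ L1).
  apply: cvg_trans L2; apply: near_eq_cvg.
  have [near1 near2] : (\forall w \near (z : C^o)^', unit_disk w) /\
      (\forall w \near (z : C^o)^', w != z).
    by split; [exact/nbhs_dnbhs/near_disk | exact: nbhs_dnbhs_neq].
  near=> w.
  have dw : unit_disk w by near: w.
  have wz : w - z != 0 by rewrite subr_eq0; near: w.
  have [f1 g1] := fg _ dw; have [f2 g2] := fg' _ dw.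
  have nz : (w - z) ^+ n * (w - z) ^+ m != 0 by rewrite mulf_neq0 ?expf_neq0.
  apply: (mulfI nz); rewrite [LHS]mulrACA [RHS]mulrACA.
  have -> : (w - z) ^+ n * F' w * ((w - z) ^+ m * G w) =
    (w - z) ^+ m * F' w * ((w - z) ^+ n * G w).
    by rewrite mulrACA [RHS]mulrACA (mulrC (_ ^+ n)).
  by rewrite -f1 -g2 -f2 -g1.
have [G0|G0] := eqVneq (G z) 0; have [G'0|G'0] := eqVneq (G' z) 0 => //.
- move/eqP: cross; rewrite G0 mulr0 mulf_eq0 (negPf G'0) orbF => /eqP F0.
  by case: FG.
- move/esym/eqP: cross; rewrite G'0 mulr0 mulf_eq0 (negPf G0) orbF => /eqP F0.
  by case: FG'.
- by congr Some; apply/eqP; rewrite eqr_div// cross.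
Unshelve. all: by end_near.
Qed.

End Bergman.

(* Main.v *)
Require Import Defs.
From HB Require Import structures.
From mathcomp Require Import all_boot all_order all_algebra.
From mathcomp Require Import all_classical all_reals all_analysis.
From mathcomp Require Import measurable_realfun complex lra.

Import Order.TTheory GRing.Theory Num.Theory.
Import numFieldNormedType.Exports.
Local Open Scope classical_set_scope.
Local Open Scope ring_scope.

(** Monomials form a minimising sequence: a high power of z keeps its mass near
the unit circle, so once normalised in the Bergman space it is small on the
disk of radius c, and it may be compared with a normalised constant.  Write I_n
for the integral of |z|^(2n) over the unit disk.  The functions
sqrt(pi / I_n) z^n and sqrt(pi / I_0) lie on the unit sphere
([monomial_sphere]), and the modulus of their quotient on |z| <= c is at most
c^n sqrt(I_0 / I_n).

The moments I_n are only estimated, which avoids polar coordinates.  For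
c < d < 1, a small rectangle between the circles of radii d and 1 gives
I_n >= A d^(2n) with A > 0 independent of n ([moment_ge]), and I_n is finite
because the disk lies in a square ([moment_finite]).  Hence the quotient is at
most sqrt(I_0 / A) (c / d)^n, which tends to 0. *)

Section Monomials.
Context {R : realType}.
Implicit Types (z w : R[i]) (n : nat) (a b d r : R) (p : R * R).

Let disk : set (R * R) := @complex_of_pair R @^-1` @unit_disk R.

Lemma cabs_ge0 z : 0 <= cabs z.
Proof. by case: z => x y; exact: sqrtr_ge0. Qed.

Lemma cabsM z w : cabs (z * w) = cabs z * cabs w.
Proof. exact: Normc.normcM. Qed.

Lemma cabsX z n : cabs (z ^+ n) = cabs z ^+ n.
Proof.
elim: n => [|n IHn]; first by rewrite !expr0 /cabs Normc.normc1.
by rewrite !exprS cabsM IHn.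
Qed.

Lemma cabs_real a : 0 <= a -> cabs a%:C%C = a.
Proof. by move=> a0; rewrite /cabs /= expr0n /= addr0 sqrtr_sqr ger0_norm. Qed.

Lemma cabs_monomial a n z : 0 <= a -> cabs (a%:C%C * z ^+ n) = a * cabs z ^+ n.
Proof. by move=> a0; rewrite cabsM cabs_real// cabsX. Qed.

Lemma cabs_pair_sqr p : cabs (complex_of_pair p) ^+ 2 = p.1 ^+ 2 + p.2 ^+ 2.
Proof. by rewrite /cabs /= sqr_sqrtr// addr_ge0// sqr_ge0. Qed.

Lemma diskE : disk = [set p | p.1 ^+ 2 + p.2 ^+ 2 < 1].
Proof.
by apply/funext => p; rewrite /disk /= -cabs_pair_sqr expr_lt1// cabs_ge0.
Qed.

Lemma measurable_sqr_cabs (D : set (R * R)) :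
  measurable_fun D (fun p : R * R => p.1 ^+ 2 + p.2 ^+ 2).
Proof.
apply: measurable_funTS; apply: measurable_funD.
  exact: measurable_funX measurable_fst.
exact: measurable_funX measurable_snd.
Qed.

Lemma measurable_disk : measurable disk.
Proof.
rewrite diskE -[X in measurable X]setTI.
have mlt : measurable_fun setT (fun p : R * R => p.1 ^+ 2 + p.2 ^+ 2 < 1).
  by apply: measurable_fun_ltr => //; exact: measurable_sqr_cabs.
exact: mlt measurableT [set true] _.
Qed.

(** The squared norm of z^n, without the factor 1 / pi; the modulus is
expanded so that the integrand is visibly a polynomial in the coordinates. *)
Definition moment n : \bar R :=
  (\int[@area_measure R]_(p in disk) ((p.1 ^+ 2 + p.2 ^+ 2) ^+ n)%:E)%E.

Let measurable_moment n D :
  measurable_fun D (fun p : R * R => ((p.1 ^+ 2 + p.2 ^+ 2) ^+ n)%:E).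
Proof.
by apply/measurable_EFinP; apply: measurable_funX; exact: measurable_sqr_cabs.
Qed.

Let moment_integrand_ge0 n p : (0 <= ((p.1 ^+ 2 + p.2 ^+ 2) ^+ n)%:E)%E.
Proof. by rewrite lee_fin exprn_ge0// addr_ge0// sqr_ge0. Qed.

Lemma area_rectangle a b c d : a <= b -> c <= d ->
  @area_measure R (`[a, b] `*` `[c, d]) = ((b - a) * (d - c))%:E.
Proof.
have len (x y : R) : x <= y -> lebesgue_measure (`[x, y] : set R) = (y - x)%:E.
  rewrite lebesgue_measure_itv/= lte_fin le_eqVlt => /orP[/eqP->|->//].
  by rewrite ltxx subrr.
move=> ab cd; etransitivity.
  by apply: product_measure1E; exact: measurable_itv.
by rewrite EFinM; congr (_ * _)%E; exact: len.
Qed.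

Lemma moment_finite n : (moment n < +oo)%E.
Proof.
have mS : measurable (`[-1, 1] `*` `[-1, 1] : set (R * R)).
  by apply: measurableX; exact: measurable_itv.
apply: (@le_lt_trans _ _ (@area_measure R (`[-1, 1] `*` `[-1, 1]))); last first.
  by rewrite area_rectangle ?ltry//; lra.
apply: (@le_trans _ _ (\int[@area_measure R]_(p in disk) cst 1%E p)%E).
  apply: ge0_le_integral => [|p _|||].
  - exact: measurable_disk.
  - exact: moment_integrand_ge0.
  - exact: measurable_moment.
  - exact: measurable_cst.
  rewrite diskE => p /= p1; rewrite lee_fin exprn_ile1 ?(ltW p1)//.
  by rewrite addr_ge0// sqr_ge0.
rewrite integral_cst ?mul1e; last exact: measurable_disk.
apply: le_measure; rewrite ?inE//; first exact: measurable_disk.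
rewrite diskE => -[x y] /= xy1; split; rewrite /= in_itv /=;
  by apply/andP; split; nra.
Qed.

(** The mass of |z|^(2n) decays no faster than d^(2n), for any d in (0, 1): the
integrand is at least d^(2n) on a rectangle [d, e] x [0, 1 - e], where
d < e < 1.  This rectangle lies in the disk since e^2 + (1 - e)^2 < 1. *)
Lemma moment_ge d : 0 < d -> d < 1 ->
  exists2 A, 0 < A & forall n, ((A * d ^+ (2 * n))%:E <= moment n)%E.
Proof.
move=> d0 d1; set e := (d + 1) / 2.
have [de e1] : d < e /\ e < 1 by rewrite /e; lra.
exists ((e - d) * (1 - e)) => [|n]; first by rewrite mulr_gt0 ?subr_gt0.
set S : set (R * R) := `[d, e] `*` `[0, 1 - e].
have mS : measurable S by apply: measurableX; exact: measurable_itv.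
have areaS : @area_measure R S = ((e - d) * (1 - e))%:E.
  by rewrite area_rectangle ?subr0// ?subr_ge0 ltW.
apply: (@le_trans _ _
    (\int[@area_measure R]_(p in S) ((p.1 ^+ 2 + p.2 ^+ 2) ^+ n)%:E)%E).
  rewrite mulrC EFinM -areaS -integral_cst//.
  apply: ge0_le_integral => [//|p _||| [x y] [/=]].
  - by rewrite lee_fin exprn_ge0// ltW.
  - exact: measurable_cst.
  - exact: measurable_moment.
  rewrite !in_itv /= => /andP[dx xe] _.
  rewrite lee_fin exprM lerXn2r// ?nnegrE ?sqr_ge0 ?addr_ge0 ?sqr_ge0//; nra.
apply: ge0_subset_integral => [//||||].
- exact: measurable_disk.
- exact: measurable_moment.
- by move=> p _; exact: moment_integrand_ge0.
rewrite diskE => -[x y] [/=]; rewrite !in_itv /= => /andP[dx xe] /andP[y0 ye].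
nra.
Qed.

Lemma monomial_sphere n : exists r : R,
  [/\ 0 < r, moment n = r%:E &
      bergman_sphere (fun z => (Num.sqrt (pi / r))%:C%C * z ^+ n)].
Proof.
have [A A0 /(_ n) momentA] : exists2 A, 0 < A &
    forall n, ((A * (1 / 2) ^+ (2 * n))%:E <= moment n)%E.
  by apply: moment_ge; lra.
have := moment_finite n; case mE : (moment n) momentA => [r| |]//.
rewrite lee_fin => Ar _.
have r0 : 0 < r by apply: lt_le_trans Ar; rewrite mulr_gt0// exprn_gt0//; lra.
have pr0 : 0 <= pi / r by rewrite divr_ge0// ?pi_ge0// ltW.
exists r; split => //.
have norm1 : bergman_norm (fun z => (Num.sqrt (pi / r))%:C%C * z ^+ n) = 1%E.
  rewrite /bergman_norm.
  under eq_integral => p _ do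
    rewrite cabs_monomial ?sqrtr_ge0// exprMn sqr_sqrtr// exprAC cabs_pair_sqr
      EFinM.
  rewrite ge0_integralZl_EFin//; first last.
  - exact: measurable_moment.
  - exact: measurable_disk.
  rewrite -/(moment n) mE -!EFinM divfK ?gt_eqF// mulVf ?gt_eqF ?pi_gt0//.
  exact: poweR1r.
split=> //; split; last by rewrite norm1 ltry.
move=> z _; apply: (@derivableZ _ _ _ (fun w : R[i]^o => w ^+ n : R[i]^o)).
(* The power rule is stated for powers in the ring of functions. *)
have -> : (fun w : R[i]^o => w ^+ n : R[i]^o) = (@id R[i]^o) ^+ n.
  by apply/funext => w; elim: n {Ar mE norm1} => // n IHn; rewrite !exprS IHn.
by apply: derivableX; exact: derivable_id.
Qed.

End Monomials.

(** No cancellation takes place where g does not vanish, and the value found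
there is the chosen one because values of the quotient are unique. *)
Lemma mero_quotient_nonvanishing (R : realType) (f g : R[i] -> R[i]) z :
  analytic_on_disk f -> analytic_on_disk g -> unit_disk z -> g z != 0 ->
  mero_quotient f g z = Some (f z / g z).
Proof.
move=> af ag dz gz.
have Q : is_quotient_at f g z (Some (f z / g z)).
  exists 0%N, f, g; split=> //; last by rewrite (negPf gz).
    by move=> w _; rewrite !expr0 !mul1r.
  by move=> [_ /eqP]; rewrite (negPf gz).
apply: (is_quotient_at_unique dz) (Q).
exact: (@xgetPex (option R[i]) None _ (ex_intro _ _ Q)).
Qed.

Lemma mero_abs_ge0 (R : realType) (v : option R[i]) : (0 <= mero_abs v)%E.
Proof. by case: v => [z|] //=; rewrite ?lee_fin ?cabs_ge0// le0y. Qed.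

Theorem mainTheorem13 (R : realType) (c : R) (hc : 0 < c < 1) :
  ereal_inf [set s : \bar R | exists f g : R[i] -> R[i],
     [/\ bergman_sphere f, bergman_sphere g
       & s = ereal_sup [set mero_abs (mero_quotient f g z)
                       | z in [set z : R[i] | cabs z <= c]]]] = 0%E.
Proof.
case/andP: hc => c0 c1; apply/eqP; rewrite eq_le; apply/andP; split; last first.
  apply: le_ereal_inf_tmp => _ [f [g [_ _ ->]]].
  apply: le_trans (mero_abs_ge0 R (mero_quotient f g 0)) _.
  apply: ereal_sup_ubound; exists 0 => //.
  have -> : [set z : R[i] | cabs z <= c] 0 = (cabs (0 : R[i]) <= c) by [].
  by rewrite /cabs Normc.normc0 ltW.
apply/lee_addgt0Pr => e e0; rewrite add0e.
(* Any radius strictly between c and 1 would do. *)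
set d := (c + 1) / 2.
have [cd d1] : c < d /\ d < 1 by rewrite /d; lra.
have d0 : 0 < d by exact: lt_trans cd.
have [A A0 momentA] := moment_ge d d0 d1.
have [r0 [r0_gt0 _ S0]] := monomial_sphere (R := R) 0%N.
have q1 : `|(c / d) ^+ 2| < 1.
  by rewrite ger0_norm ?sqr_ge0// expr_lt1// ?ltr_pdivrMr ?mul1r// divr_ge0// ltW.
(* This n makes the bound (c / d)^(2n) r0 / A for the square of the quotient
   smaller than e^2. *)
have [n small] : exists n, ((c / d) ^+ 2) ^+ n < e ^+ 2 * A / r0.
  have e'0 : 0 < e ^+ 2 * A / r0 by rewrite !mulr_gt0// ?exprn_gt0// invr_gt0.
  have /cvgrPdist_lt/(_ _ e'0)[n _ /(_ n (leqnn n))] := cvg_expr q1.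
  by rewrite /= sub0r normrN => /ltr_normlW; exists n.
have [r [r_gt0 rE Sn]] := monomial_sphere (R := R) n.
apply: ge_ereal_inf; eexists.
  by do 2 eexists; split; [exact: Sn|exact: S0|].
apply: ge_ereal_sup => _ [z /= zc <-].
have s0 : 0 < Num.sqrt (pi / r0) by rewrite sqrtr_gt0 divr_gt0// pi_gt0.
rewrite mero_quotient_nonvanishing; first last.
- by rewrite expr0 mulr1 -(rmorph0 (@real_complex R)) (inj_eq (@complexI R)) gt_eqF.
- exact: le_lt_trans zc c1.
- by case: S0 => -[].
- by case: Sn => -[].
rewrite /= lee_fin expr0 mulr1 cabsM [cabs _^-1]Normc.normcV -/(cabs _).
rewrite cabs_monomial ?sqrtr_ge0// cabs_real ?(ltW s0)//.
have key : c ^+ n ^+ 2 * r0 <= e ^+ 2 * r.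
  (* Both sides are separated by e^2 A d^(2n). *)
  have := momentA n; rewrite rE lee_fin => /(ler_wpM2l (sqr_ge0 e)).
  apply: le_trans; rewrite -exprM mulnC mulrA -ler_pdivrMr ?exprn_gt0//.
  rewrite mulrAC -expr_div_n exprM -ler_pdivlMr//; exact: ltW.
have pi_div_sqr (x : R) : 0 < x -> Num.sqrt (pi / x) ^+ 2 = pi / x.
  by move=> x0; rewrite sqr_sqrtr// divr_ge0// ?pi_ge0// ltW.
have zn_cn : cabs z ^+ n <= c ^+ n by rewrite lerXn2r ?nnegrE ?cabs_ge0 ?(ltW c0).
rewrite ler_pdivrMr//; apply: (@le_trans _ _ (Num.sqrt (pi / r) * c ^+ n)).
  by rewrite ler_wpM2l ?sqrtr_ge0.
rewrite -ler_sqr ?nnegrE ?mulr_ge0 ?exprn_ge0 ?sqrtr_ge0 ?(ltW c0) ?(ltW e0)//.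
rewrite !exprMn !pi_div_sqr// -mulrA [leRHS]mulrCA ler_pM2l ?pi_gt0//.
by rewrite ler_pdivrMl// mulrA ler_pdivlMr// [leRHS]mulrC.
Qed.
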